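(* Let $F$ be a hyperfield, $\mathcal O$ a valuation hyperring in $F$, and $\mathcal O^\times=\{x\in\mathcal O\mid x^{-1}\in\mathcal O\}$ its group of units. Consider the (multiplicative) group $\Gamma:=F^\times/\mathcal O^\times$ and define a relation $\le$ on $\Gamma$ by $$a\mathcal O^\times\le b\mathcal O^\times\iff ba^{-1}\in\mathcal O .$$ Then $(\Gamma,\cdot,\le)$ is an ordered abelian group, and the canonical projection $\pi:F\to\Gamma\cup\{\infty\}$, $\pi(a)=a\mathcal O^\times$ for $a\in F^\times$, extended by $\pi(0)=\infty$, is a valuation on $F$.
   Context: A hyperoperation $+$ on a nonempty set $H$ assigns to each $(x,y)\in H\times H$ a nonempty subset $x+y\subseteq H$; for subsets, $A+B=\bigcup_{a\in A,b\in B}(a+b)$. A canonical hypergroup is $(H,+,0)$ with $+$ an associative and commutative hyperoperation such that for every $x$ there is a unique $-x$ with $0\in x+(-x)$, and $z\in x+y$ implies $y\in z-x:=z+(-x)$. A hyperring is $(R,+,\cdot,0)$ with $(R,+,0)$ a canonical hypergroup, $(R,\cdot)$ a commutative semigroup with $x\cdot 0=0$, and $x(y+z)=xy+xz$ as sets. A hyperfield is a hyperring $F$ with unity $1\neq 0$ such that $F^\times=F\setminus\{0\}$ is a group under multiplication. A subset $S$ of a hyperring $R$ is a subhyperring if it is multiplicatively closed and, with $a+_S b:=(a+b)\cap S$, it is itself a hyperring $(S,+_S,\cdot,0)$. A valuation hyperring of a hyperfield $F$ is a subhyperring $\mathcal O$ of $F$ such that for all $x\in F$, $x\in\mathcal O$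 or $x^{-1}\in\mathcal O$ (for $x=0$ this means $0\in\mathcal O$). A valuation on $F$ with values in a (linearly) ordered abelian group $\Gamma$ (here written multiplicatively, in general additively) is a map $v:F\to\Gamma\cup\{\infty\}$, where $\infty$ is larger than all elements of $\Gamma$ and absorbing for the group operation, with: $v(a)=\infty$ iff $a=0$; $v(ab)$ is the product (sum) of $v(a)$ and $v(b)$ in $\Gamma\cup\{\infty\}$; $c\in a+b\Rightarrow v(c)\ge\min\{v(a),v(b)\}$. *)

(* Defs.v *)
From HB Require Import structures.
From mathcomp Require Import all_boot.
From mathcomp Require Import boolp classical_sets.

Set Implicit Arguments.
Unset Strict Implicit.
Unset Printing Implicit Defensive.

Local Open Scope classical_set_scope.

Definition set_hadd H (add : H -> H -> set H) (A B : set H) : set H :=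
  \bigcup_(a in A) \bigcup_(b in B) add a b.

(* In [ch_rev], the hypothesis [add x x' zero] says that x' = -x. *)
Record canonical_hypergroup H (add : H -> H -> set H) (zero : H) : Prop := {
  ch_nonempty : forall x y, add x y !=set0;
  ch_addA : forall x y z,
    set_hadd add (add x y) [set z] = set_hadd add [set x] (add y z);
  ch_addC : commutative add;
  ch_opp : forall x, exists! x', add x x' zero;
  ch_rev : forall x x' y z, add x x' zero -> add x y z -> add z x' y
}.

Record hyperring R (add : R -> R -> set R) (mul : R -> R -> R) (zero : R) :
    Prop := {
  hr_add : canonical_hypergroup add zero;
  hr_mulA : associative mul;
  hr_mulC : commutative mul;
  hr_mul0 : right_zero zero mul;
  hr_mulDr : forall x y z, mul x @` add y z = add (mul x y) (mul x z)
}.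

(* [hinv] is unconstrained at 0, and is only ever used at nonzero elements. *)
HB.mixin Record isHyperfield F := {
  hadd : F -> F -> set F;
  hmul : F -> F -> F;
  hzero : F;
  hone : F;
  hinv : F -> F;
  hyperfield_hyperring : hyperring hadd hmul hzero;
  hmul1 : left_id hone hmul;
  hone_neq0 : hone <> hzero;
  hmul_neq0 : forall x y, x <> hzero -> y <> hzero -> hmul x y <> hzero;
  hinv_neq0 : forall x, x <> hzero -> hinv x <> hzero;
  hmulV : forall x, x <> hzero -> hmul (hinv x) x = hone
}.

#[short(type="hyperfieldType")]
HB.structure Definition Hyperfield := {F of isHyperfield F}.

Arguments hzero {s}.
Arguments hone {s}.

(* The hyperoperation of S, with (a + b) `&` S seen as a subset of the
   subtype of elements of S. *)
Definition subhyperring R (add : R -> R -> set R) (mul : R -> R -> R)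
    (zero : R) (S : set R) : Prop :=
  exists (S0 : S zero) (SM : forall x y, S x -> S y -> S (mul x y)),
    hyperring
      (fun a b : {x | S x} => [set c | add (sval a) (sval b) (sval c)])
      (fun a b => exist S (mul (sval a) (sval b)) (SM _ _ (svalP a) (svalP b)))
      (exist S zero S0).

Section OrderedAbelianGroup.
Variables (G : Type) (mul : G -> G -> G) (le : rel G).

Record ordered_abelian_group : Prop := {
  oag_mulA : associative mul;
  oag_mulC : commutative mul;
  oag_group : exists e, left_id e mul /\ (forall x, exists y, mul y x = e);
  oag_refl : reflexive le;
  oag_anti : antisymmetric le;
  oag_trans : transitive le;
  oag_total : total le;
  oag_le_mul : forall x y z, le x y -> le (mul z x) (mul z y)
}.

(* [option G] stands for G with a largest, absorbing element [None]. *)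
Definition inf_mul (x y : option G) : option G :=
  if (x, y) is (Some a, Some b) then Some (mul a b) else None.

Definition inf_le (x y : option G) : bool :=
  match x, y with
  | _, None => true
  | None, Some _ => false
  | Some a, Some b => le a b
  end.

Definition inf_min (x y : option G) : option G := if inf_le x y then x else y.

Record valuation (F : hyperfieldType) (v : F -> option G) : Prop := {
  val_inf : forall a, v a = None <-> a = hzero;
  val_mul : forall a b, v (hmul a b) = inf_mul (v a) (v b);
  val_add : forall a b c, hadd a b c -> inf_le (inf_min (v a) (v b)) (v c)
}.

End OrderedAbelianGroup.

Section ValuationHyperring.
Variables (F : hyperfieldType) (O : set F).

Record valuation_hyperring : Prop := {
  vhr_sub : subhyperring hadd hmul hzero O;
  vhr_total : forall x, O x \/ (x <> hzero /\ O (hinv x))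
}.

Definition vunits : set F := [set x | [/\ O x, x <> hzero & O (hinv x)]].

Definition vcoset (a : F) : set F := [set hmul a u | u in vunits].

Definition value_group : Type :=
  {A : set F | exists2 a, a <> hzero & A = vcoset a}.

Definition vclass (a : F) (a0 : a <> hzero) : value_group :=
  exist _ (vcoset a) (ex_intro2 _ _ a a0 erefl).

Definition value_le (A B : value_group) : bool :=
  `[< exists a b, [/\ a <> hzero, b <> hzero, sval A = vcoset a,
                      sval B = vcoset b & O (hmul b (hinv a))] >].

Definition vproj (a : F) : option value_group :=
  match pselect (a = hzero) with
  | left _ => None
  | right a0 => Some (vclass a0)
  end.

Definition set_hmul (A B : set F) : set F := [set hmul a b | a in A & b in B].

Hypothesis HO : valuation_hyperring.

Lemma vcosetM (a b : F) :
  set_hmul (vcoset a) (vcoset b) = vcoset (hmul a b).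
Proof.
have [[_ mA mC m0 _] [sub tot]] := (@hyperfield_hyperring F, HO).
have [_ [SM _]] := sub.
have mV (x : F) : x <> hzero -> hmul x (hinv x) = hone.
  by move=> x0; rewrite mC hmulV.
have O1 : O hone.
  have i1 : hinv hone = hone :> F by rewrite -[LHS]hmul1 mV //; exact: hone_neq0.
  by case: (tot hone) => // -[_]; rewrite i1.
have U1 : vunits hone.
  split=> //; first exact: hone_neq0.
  by rewrite -[hinv _]hmul1 mV //; exact: hone_neq0.
have invM (u v : F) : u <> hzero -> v <> hzero ->
    hinv (hmul u v) = hmul (hinv u) (hinv v).
  move=> u0 v0; have uv0 := hmul_neq0 _ _ u0 v0.
  have e : hmul (hmul (hinv u) (hinv v)) (hmul u v) = hone.
    by rewrite [hmul u v]mC -mA [hmul (hinv v) _]mA hmulV // hmul1 hmulV.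
  by rewrite -[LHS]hmul1 -e -mA mV // mC hmul1.
rewrite /set_hmul; apply/seteqP; split=> [_ [_ [u uU <-]] [_ [v vU <-]] <-|].
  exists (hmul u v).
    have [Ou u0 Ou'] := uU; have [Ov v0 Ov'] := vU.
    split; [exact: SM|exact: hmul_neq0|].
    by rewrite invM //; exact: SM.
  by rewrite !mA; congr hmul; rewrite -!mA; congr hmul; exact: mC.
move=> _ [u uU <-]; exists (hmul a u); first by exists u.
exists (hmul b hone); first by exists hone.
by rewrite [hmul b _]mC hmul1 -!mA; congr hmul; exact: mC.
Qed.

Lemma value_mul_subproof (A B : value_group) :
  exists2 c, c <> hzero & set_hmul (sval A) (sval B) = vcoset c.
Proof.
case: (svalP A) (svalP B) => [a a0 ->] [b b0 ->].
by exists (hmul a b); [exact: hmul_neq0|exact: vcosetM].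
Qed.

Definition value_mul (A B : value_group) : value_group :=
  exist _ (set_hmul (sval A) (sval B)) (value_mul_subproof A B).

End ValuationHyperring.

(* Main.v *)
Require Import Defs.
From mathcomp Require Import all_boot.
From mathcomp Require Import boolp classical_sets.

(** The quotient [F^* / O^*] is an abelian group, and on classes the relation
  [b a^-1 \in O] does not depend on representatives, because two representatives
  differ by a unit of [O] ([value_leE]).  Reflexivity, transitivity and
  compatibility with products follow from [1 \in O] and from [O O] being
  contained in [O]; antisymmetry is the definition of [O^*], and totality is the
  defining property of a valuation hyperring, applied to [b a^-1].

  The only point where the hyperaddition matters is the ultrametric inequality.
  After division by the summand of smaller value it says that
  [1 + u] is contained in [O] for every [u] in [O] ([vhr_add1]).  This is not
  immediate, since a subhyperring only has to be a hyperring for the truncated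
  sums [(a + b) `&` O] and may fail to contain [a + b].  It holds because
  distributivity is required of the truncated sums as well: if [x \in 1 + u]
  and [m = x^-1] lies in [O], then [1 = m x] is an element of [m + m u] lying
  in [O], so that it is [m y] for some [y \in 1 + u] lying in [O]; hence
  [x = y]. *)

Local Open Scope classical_set_scope.

(** * Arithmetic in a hyperfield *)

Lemma hmulA {F : hyperfieldType} (x y z : F) :
  hmul x (hmul y z) = hmul (hmul x y) z.
Proof. exact: (hr_mulA (@hyperfield_hyperring F)). Qed.

Lemma hmulC {F : hyperfieldType} (x y : F) : hmul x y = hmul y x.
Proof. exact: (hr_mulC (@hyperfield_hyperring F)). Qed.

Lemma hmulx0 {F : hyperfieldType} (x : F) : hmul x hzero = hzero.
Proof. exact: (hr_mul0 (@hyperfield_hyperring F)). Qed.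

Lemma haddC {F : hyperfieldType} (x y : F) : hadd x y = hadd y x.
Proof. exact: (ch_addC (hr_add (@hyperfield_hyperring F))). Qed.

Lemma hmul_hadd {F : hyperfieldType} (x y z c : F) :
  hadd y z c -> hadd (hmul x y) (hmul x z) (hmul x c).
Proof.
by move=> yzc; rewrite -(hr_mulDr (@hyperfield_hyperring F)); exists c.
Qed.

(** The subset [0 + 0] is [0 (1 + 1)], all of whose elements are zero. *)
Lemma hadd00 {F : hyperfieldType} (c : F) : hadd hzero hzero c -> c = hzero.
Proof.
rewrite -{1 2}[hzero](hmulx0 hone) hmulC.
rewrite -(hr_mulDr (@hyperfield_hyperring F)) => -[w _ <-].
by rewrite hmulC hmulx0.
Qed.

Lemma hmulr1 {F : hyperfieldType} (x : F) : hmul x hone = x.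
Proof. by rewrite hmulC hmul1. Qed.

Lemma hmulrV {F : hyperfieldType} (x : F) :
  x <> hzero -> hmul x (hinv x) = hone.
Proof. by move=> x0; rewrite hmulC hmulV. Qed.

Lemma hmulVK {F : hyperfieldType} {a : F} (b : F) :
  a <> hzero -> hmul a (hmul b (hinv a)) = b.
Proof. by move=> a0; rewrite hmulA [hmul a b]hmulC -hmulA hmulrV // hmulr1. Qed.

Lemma hinv_uniq {F : hyperfieldType} (x y : F) :
  x <> hzero -> hmul x y = hone -> hinv x = y.
Proof. by move=> x0 xy1; rewrite -[LHS]hmulr1 -xy1 hmulA hmulV // hmul1. Qed.

Lemma hmulACA {F : hyperfieldType} (a b c d : F) :
  hmul (hmul a b) (hmul c d) = hmul (hmul a c) (hmul b d).
Proof.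
by rewrite -!hmulA; congr hmul; rewrite !hmulA; congr hmul; exact: hmulC.
Qed.

Lemma hinvM {F : hyperfieldType} (x y : F) :
  x <> hzero -> y <> hzero -> hinv (hmul x y) = hmul (hinv x) (hinv y).
Proof.
move=> x0 y0; apply: hinv_uniq; first exact: hmul_neq0.
by rewrite hmulACA !hmulrV // hmul1.
Qed.

Lemma hinv_div {F : hyperfieldType} (a b : F) :
  a <> hzero -> b <> hzero -> hinv (hmul b (hinv a)) = hmul a (hinv b).
Proof.
move=> a0 b0; apply: hinv_uniq; first by apply: hmul_neq0 => //; exact: hinv_neq0.
by rewrite hmulACA [hmul b a]hmulC -hmulACA !hmulrV // hmul1.
Qed.

(** * Valuation hyperrings *)

Lemma vhr0 {F : hyperfieldType} {O : set F} :
  valuation_hyperring O -> O hzero.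
Proof. by case=> -[]. Qed.

Lemma vhrM {F : hyperfieldType} {O : set F} (x y : F) :
  valuation_hyperring O -> O x -> O y -> O (hmul x y).
Proof. by case=> -[_ [OM _]] _; exact: OM. Qed.

Lemma vhr1 {F : hyperfieldType} {O : set F} :
  valuation_hyperring O -> O hone.
Proof.
have one0 := @hone_neq0 F.
case=> _ /(_ hone) [//|[_]].
by rewrite (hinv_uniq _ hone one0 (hmul1 _)).
Qed.

(** [O] is saturated for distributivity: if [m + m u] meets [O] in [d], then
  [d] is already a multiple of [m] by an element of the truncated sum
  [(1 + u) `&` O]. *)
Lemma vhr_add1 {F : hyperfieldType} {O : set F} (u x : F) :
  valuation_hyperring O -> O u -> hadd hone u x -> O x.
Proof.
move=> HO Ou ux.
have [//|[x0 Om]] := vhr_total HO x.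
have O1 := vhr1 HO.
have := hmul_hadd (hinv x) _ _ _ ux; rewrite hmulr1 hmulV // => m1.
case: (vhr_sub HO) => O0 [OM OR].
have := hr_mulDr OR (exist _ _ Om) (exist _ _ O1) (exist _ _ Ou).
move=> /seteqP[_ /(_ (exist _ _ O1))] /=; rewrite hmulr1.
move=> /(_ m1) [[y Oy] _ /(congr1 sval) /= my1].
by rewrite -[x]hmulr1 -my1 hmulA hmulrV // hmul1.
Qed.

(** * The value group *)

Lemma vcoset_refl {F : hyperfieldType} {O : set F} (a : F) :
  valuation_hyperring O -> vcoset O a a.
Proof.
move=> HO; exists hone; last exact: hmulr1.
split; [exact: vhr1|exact: hone_neq0|].
by rewrite (hinv_uniq _ hone) ?hmul1//; [exact: vhr1|exact: hone_neq0].
Qed.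

Lemma vcosetMunit {F : hyperfieldType} {O : set F} (a u : F) :
  valuation_hyperring O -> vunits O u ->
  vcoset O (hmul a u) `<=` vcoset O a.
Proof.
move=> HO [Ou u0 OVu] _ [w [Ow w0 OVw] <-].
exists (hmul u w); last exact: hmulA.
by split; [exact: vhrM|exact: hmul_neq0|rewrite hinvM //; exact: vhrM].
Qed.

Lemma value_group_inj {F : hyperfieldType} {O : set F} (A B : value_group O) :
  sval A = sval B -> A = B.
Proof. by case: A B => [A PA] [B PB] /= AB; exact: eq_exist. Qed.

Lemma value_groupP {F : hyperfieldType} {O : set F} (A : value_group O) :
  exists a (a0 : a <> hzero), A = vclass O a0.
Proof.
case: (svalP A) => a a0 Aa; exists a, a0; exact: value_group_inj.
Qed.

Lemma vclassM {F : hyperfieldType} {O : set F} (HO : valuation_hyperring O)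
    (a b : F) (a0 : a <> hzero) (b0 : b <> hzero) :
  value_mul HO (vclass O a0) (vclass O b0) = vclass O (hmul_neq0 a b a0 b0).
Proof. by apply: value_group_inj; exact: vcosetM. Qed.

(** If [a = a' u] and [b = b' w] with [u], [w] units, then [b a^-1] is
  [b' a'^-1] multiplied by the unit [w u^-1]. *)
Lemma value_leE {F : hyperfieldType} {O : set F} (HO : valuation_hyperring O)
    {a b : F} (a0 : a <> hzero) (b0 : b <> hzero) :
  value_le (vclass O a0) (vclass O b0) <-> O (hmul b (hinv a)).
Proof.
split=> [/asboolP[a' [b' [a'0 b'0 /= aa' bb' Oab]]]|Oab]; last first.
  by apply/asboolP; exists a, b.
have := vcoset_refl a HO; rewrite aa' => -[u [Ou u0 OVu] <-].
have := vcoset_refl b HO; rewrite bb' => -[w [Ow w0 OVw] <-].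
by rewrite hinvM // hmulACA; apply: vhrM => //; exact: vhrM.
Qed.

Lemma value_le_refl {F : hyperfieldType} {O : set F} :
  valuation_hyperring O -> reflexive (@value_le F O).
Proof.
move=> HO A; have [a [a0 ->]] := value_groupP A.
by apply/(value_leE HO); rewrite hmulrV //; exact: vhr1.
Qed.

Lemma value_le_anti {F : hyperfieldType} {O : set F} :
  valuation_hyperring O -> antisymmetric (@value_le F O).
Proof.
move=> HO A B.
have [a [a0 ->]] := value_groupP A; have [b [b0 ->]] := value_groupP B.
move=> /andP[/(value_leE HO) Oab /(value_leE HO) Oba].
have quot_unit c d : c <> hzero -> d <> hzero -> O (hmul d (hinv c)) ->
    O (hmul c (hinv d)) -> vcoset O d `<=` vcoset O c.
  move=> c0 d0 Odc Ocd; rewrite -[in vcoset O d](hmulVK d c0).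
  apply: vcosetMunit => //; split=> //; last by rewrite hinv_div.
  by apply: hmul_neq0 => //; exact: hinv_neq0.
by apply: value_group_inj; apply/seteqP; split; exact: quot_unit.
Qed.

Lemma value_le_trans {F : hyperfieldType} {O : set F} :
  valuation_hyperring O -> transitive (@value_le F O).
Proof.
move=> HO B A C.
have [a [a0 ->]] := value_groupP A; have [b [b0 ->]] := value_groupP B.
have [c [c0 ->]] := value_groupP C.
move=> /(value_leE HO) Oab /(value_leE HO) Obc; apply/(value_leE HO).
rewrite -[c](hmulVK c b0) [hmul b _]hmulC -hmulA; exact: vhrM.
Qed.

Lemma value_le_total {F : hyperfieldType} {O : set F} :
  valuation_hyperring O -> total (@value_le F O).
Proof.
move=> HO A B.
have [a [a0 ->]] := value_groupP A; have [b [b0 ->]] := value_groupP B.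
apply/orP; case: (vhr_total HO (hmul b (hinv a))) => [Oab|[_]].
  by left; apply/(value_leE HO).
by rewrite hinv_div // => Oba; right; apply/(value_leE HO).
Qed.

Lemma value_le_mul {F : hyperfieldType} {O : set F}
    (HO : valuation_hyperring O) (A B C : value_group O) :
  value_le A B -> value_le (value_mul HO C A) (value_mul HO C B).
Proof.
have [a [a0 ->]] := value_groupP A; have [b [b0 ->]] := value_groupP B.
have [c [c0 ->]] := value_groupP C; rewrite !vclassM.
move=> /(value_leE HO) Oab; apply/(value_leE HO).
by rewrite hinvM // hmulACA hmulrV // hmul1.
Qed.

Lemma value_group_ordered {F : hyperfieldType} {O : set F}
    (HO : valuation_hyperring O) :
  ordered_abelian_group (value_mul HO) (@value_le F O).
Proof.
split.
- move=> A B C.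
  have [a [a0 ->]] := value_groupP A; have [b [b0 ->]] := value_groupP B.
  have [c [c0 ->]] := value_groupP C; rewrite !vclassM.
  by apply: value_group_inj; rewrite /= hmulA.
- move=> A B.
  have [a [a0 ->]] := value_groupP A; have [b [b0 ->]] := value_groupP B.
  by rewrite !vclassM; apply: value_group_inj; rewrite /= hmulC.
- exists (vclass O (@hone_neq0 F)); split=> A; have [a [a0 ->]] := value_groupP A.
    by rewrite vclassM; apply: value_group_inj; rewrite /= hmul1.
  exists (vclass O (hinv_neq0 a a0)).
  by rewrite vclassM; apply: value_group_inj; rewrite /= hmulV.
- exact: value_le_refl.
- exact: value_le_anti.
- exact: value_le_trans.
- exact: value_le_total.
- exact: value_le_mul.
Qed.

(** * The canonical projection *)

Lemma vproj0 {F : hyperfieldType} {O : set F} : vproj O hzero = None.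
Proof. by rewrite /vproj; case: pselect. Qed.

Lemma vproj_neq0 {F : hyperfieldType} {O : set F} {a : F}
    (a0 : a <> hzero) : vproj O a = Some (vclass O a0).
Proof.
rewrite /vproj; case: pselect => // a0'.
by congr Some; exact: value_group_inj.
Qed.

Lemma vproj_eq_inf {F : hyperfieldType} {O : set F} (a : F) :
  vproj O a = None <-> a = hzero.
Proof.
split=> [|->]; last exact: vproj0.
by case: (pselect (a = hzero)) => // a0; rewrite (vproj_neq0 a0).
Qed.

Lemma vprojM {F : hyperfieldType} {O : set F} (HO : valuation_hyperring O)
    (a b : F) :
  vproj O (hmul a b) = inf_mul (value_mul HO) (vproj O a) (vproj O b).
Proof.
case: (pselect (a = hzero)) => [->|a0]; first by rewrite hmulC hmulx0 vproj0.
case: (pselect (b = hzero)) => [->|b0].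
  by rewrite hmulx0 vproj0 (vproj_neq0 a0).
rewrite (vproj_neq0 a0) (vproj_neq0 b0) (vproj_neq0 (hmul_neq0 a b a0 b0)).
by rewrite /inf_mul vclassM.
Qed.

Lemma vproj_le_total {F : hyperfieldType} {O : set F} (a b : F) :
  valuation_hyperring O ->
  inf_le (@value_le F O) (vproj O a) (vproj O b)
  || inf_le (@value_le F O) (vproj O b) (vproj O a).
Proof.
move=> HO; case: (vproj O a) (vproj O b) => [A|] [B|] //.
exact: value_le_total.
Qed.

(** Dividing by [a] turns [c \in a + b] into [c a^-1 \in 1 + b a^-1], which
  gives [c a^-1 \in O] by [vhr_add1]. *)
Lemma vproj_hadd_le {F : hyperfieldType} {O : set F} (a b c : F) :
  valuation_hyperring O -> hadd a b c ->
  inf_le (@value_le F O) (vproj O a) (vproj O b) ->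
  inf_le (@value_le F O) (vproj O a) (vproj O c).
Proof.
move=> HO abc.
case: (pselect (c = hzero)) => [->|c0]; first by rewrite vproj0; case: vproj.
case: (pselect (a = hzero)) => [a0|a0].
  move: abc; rewrite a0 vproj0; case: (pselect (b = hzero)) => [->|b0].
    by move/hadd00.
  by rewrite (vproj_neq0 b0).
have O_quot : O (hmul b (hinv a)) -> O (hmul c (hinv a)).
  move=> Oab; apply: vhr_add1 HO Oab _.
  rewrite -(hmulV a a0) ![hmul _ (hinv a)]hmulC; exact: hmul_hadd.
rewrite (vproj_neq0 a0) (vproj_neq0 c0) => le_ab; apply/(value_leE HO)/O_quot.
case: (pselect (b = hzero)) le_ab => [->|b0].
  by rewrite hmulC hmulx0; move=> _; exact: vhr0.
by rewrite (vproj_neq0 b0) => /(value_leE HO).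
Qed.

Lemma vproj_valuation {F : hyperfieldType} {O : set F}
    (HO : valuation_hyperring O) :
  valuation (value_mul HO) (@value_le F O) (vproj O).
Proof.
split; [exact: vproj_eq_inf|exact: vprojM|move=> a b c abc].
rewrite /inf_min; case: ifPn => [|/negPf Nab]; first exact: vproj_hadd_le.
apply: (@vproj_hadd_le _ _ b a) => //; first by rewrite haddC.
by have := vproj_le_total a b HO; rewrite Nab.
Qed.

Theorem proposition4p12 (F : hyperfieldType) (O : set F)
    (HO : valuation_hyperring O) :
  [/\ forall (a b : F) (a0 : a <> hzero) (b0 : b <> hzero),
        value_le (vclass O a0) (vclass O b0) <-> O (hmul b (hinv a)),
      ordered_abelian_group (value_mul HO) (@value_le F O)
    & valuation (value_mul HO) (@value_le F O) (vproj O)].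
Proof.
split; first by move=> a b a0 b0; exact: value_leE.
- exact: value_group_ordered.
- exact: vproj_valuation.
Qed.
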